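(* For every positive integer $n$, there exists a c-forest-Wilf equivalence class containing at least $2^{n-4}$ patterns of length $n$.
   Context: A rooted labeled forest on $[n]$ is an unordered forest on $n$ vertices, each component with a distinguished root, with distinct vertex labels from $[n]$. A pattern of length $k$ is a permutation of $[k]$. A consecutive instance of $\pi$ in a forest is a sequence of vertices $v_1,\dots,v_k$ with $v_i$ the parent of $v_{i+1}$ for all $i$ (a downward path) whose labels are in the same relative order as $\pi$. A forest consecutively avoids $\pi$ if it has no consecutive instance of $\pi$. Two patterns are c-forest-Wilf equivalent if for every $n\ge0$ the numbers of rooted labeled forests on $[n]$ consecutively avoiding each of them are equal; a c-forest-Wilf equivalence class is an equivalence class of patterns under this relation. *)

(* Defs.v *)
From mathcomp Require Import all_boot all_order all_fingroup.
Set Implicit Arguments. Unset Strict Implicit. Unset Printing Implicit Defensive.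

(* A rooted labeled forest on [n] (vertices = labels = 'I_n) is encoded by its
   parent map: par v = Some u if u is the parent of v, None if v is a root.
   The map must be acyclic: iterating "go to parent" from any vertex reaches
   a root (None) within n steps.  Such parent maps are in bijection with
   rooted labeled forests on [n]. *)
Definition parent_step (n : nat) (par : {ffun 'I_n -> option 'I_n})
  (x : option 'I_n) : option 'I_n := obind par x.

Definition is_forest (n : nat) (par : {ffun 'I_n -> option 'I_n}) : bool :=
  [forall v : 'I_n, iter n (parent_step par) (Some v) == None].

Definition cinstance (n k : nat) (par : {ffun 'I_n -> option 'I_n})
  (pi : 'S_k) (v : {ffun 'I_k -> 'I_n}) : bool :=
  [forall i : 'I_k, forall j : 'I_k,
     (val j == (val i).+1) ==> (par (v j) == Some (v i))] &&
  [forall i : 'I_k, forall j : 'I_k,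
     ((v i < v j)%N == (pi i < pi j)%N)].

Definition cavoids (n k : nat) (par : {ffun 'I_n -> option 'I_n})
  (pi : 'S_k) : bool :=
  ~~ [exists v : {ffun 'I_k -> 'I_n}, cinstance par pi v].

Definition num_cavoid (n k : nat) (pi : 'S_k) : nat :=
  #|[set par : {ffun 'I_n -> option 'I_n} | is_forest par && cavoids par pi]|.

Definition cforest_wilf_equiv (k l : nat) (p : 'S_k) (q : 'S_l) : Prop :=
  forall n : nat, num_cavoid n p = num_cavoid n q.

(* Main.v *)
Require Import Defs.
From mathcomp Require Import all_boot all_order all_fingroup.
From mathcomp Require Import zify.
Set Implicit Arguments. Unset Strict Implicit. Unset Printing Implicit Defensive.

(* The patterns are 1 2 h x y x' y' x'' ... with every x below h and every y
   above h, where each x (resp. y) is either smaller than all later x's (resp.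
   y's) or larger than all of them; these choices form a binary word of length
   n - 5, and complementation doubles the number of patterns.

   By inclusion-exclusion it suffices to count forests with a set of marked
   occurrences.  The first three entries of a pattern are its only consecutive
   double ascent, so a vertex is used by the marked occurrences at most once
   among the positions >= 3 (1-based).  Another occurrence can hang below a
   vertex v of a marked occurrence in two ways: v is its first entry, and then
   only the label of v matters, or v is its second entry, and then v is a top
   of an ascent (an h or a y) and again only its label matters.  To change the
   word at one position, together with all later positions of the same parity,
   reverse the order of the labels occupying these positions below each common
   prefix of marked occurrences, and leave everything hanging below a label
   attached to that label.  The set of labels of ascent tops does not change,
   and this is an involution on marked forests that switches the pattern. *)

(** * The order on positions determined by a word, and the effect of a flip on it *)

Section WordOrder.
Variable M : nat.
Implicit Types (w : pred nat) (a b c d : nat).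

(* Positions in a pattern of length M + 3 are counted from its last entry, so
   that M + 2, M + 1, M are the positions of 1, 2, h, and a position d < M
   carries an x if M - d is odd and a y otherwise. *)
Definition side d := if odd (M - d) then 0 else if d < M then 2 else 1.

(* If [w d], the entry at position [d] is smaller than all later entries on its
   side, otherwise it is larger than all of them. *)
Definition word_lt w a b :=
  if (M < a) || (M < b) then b < a
  else if side a == side b then if b < a then w a else (a < b) && ~~ w b
  else side a < side b.

(** Positions count from the end, so [d <= I] means at or after [I] in the pattern; equal parity
    keeps to one side. *)
Definition in_flip I d := (d <= I) && (odd d == odd I).
Definition flip_word I w : pred nat := fun d => w d (+) in_flip I d.

Lemma word_lt_irr w : irreflexive (word_lt w).
Proof. by move=> a; rewrite /word_lt eqxx ltnn; case: ifP. Qed.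

Lemma word_lt_trans w : transitive (word_lt w).
Proof.
move=> b a c; rewrite /word_lt.
move: (side a) (side b) (side c) => sa sb sc.
case: (ltngtP a b) => ?; case: (ltngtP b c) => ?; case: (ltngtP a c) => ?; try lia; subst;
repeat match goal with
    | |- context [if ?x then _ else _] => let E := fresh in destruct x eqn:E
    end; try done; lia.
Qed.

Lemma word_lt_total w a b : a <> b -> word_lt w a b || word_lt w b a.
Proof.
rewrite /word_lt [(M < b) || _]orbC; move: (side a) (side b) => sa sb.
case: ifP => _; case: (ltngtP a b) => // ? _.
all: case: (ltngtP sa sb) => ? //=; first [by case: (w a) | by case: (w b)].
Qed.

(** From [h] on, neighbouring entries lie on different sides, so ascents depend on parity alone and
    not on the word. *)
Lemma word_lt_step w d : d < M -> word_lt w d.+1 d = ~~ odd (M - d).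
Proof.
move=> dM; rewrite /word_lt /side.
have -> : (M < d.+1) || (M < d) = false by lia.
rewrite dM subnS.
have -> : odd (M - d).-1 = ~~ odd (M - d) by lia.
by case: (odd (M - d)) => //=; case: (d.+1 < M).
Qed.

Lemma flip_wordK I w : flip_word I (flip_word I w) =1 w.
Proof. by move=> d; rewrite /flip_word -addbA addbb addbF. Qed.

Lemma flip_word_out I w a b : ~~ in_flip I a -> ~~ in_flip I b ->
  word_lt (flip_word I w) a b = word_lt w a b.
Proof. by move=> /negbTE Ha /negbTE Hb; rewrite /word_lt /flip_word Ha Hb !addbF. Qed.

Lemma side_flip I a b : I < M -> in_flip I a -> in_flip I b -> side a = side b.
Proof.
move=> IM /andP[aI /eqP oa] /andP[bI /eqP ob]; rewrite /side.
have -> : odd (M - a) = odd (M - b) by lia.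
have -> : a < M by lia.
by have -> : b < M by lia.
Qed.

Lemma side_neq I a b : I < M -> in_flip I a -> b <= I -> ~~ in_flip I b -> side a != side b.
Proof.
move=> IM /andP[aI oa]; rewrite /in_flip /side => bI.
rewrite bI /= => ob.
have -> : a < M by lia.
have -> : b < M by lia.
have -> : odd (M - a) = ~~ odd (M - b) by lia.
by case: odd.
Qed.

Lemma flip_word_in I w a b : I < M -> in_flip I a -> in_flip I b ->
  word_lt (flip_word I w) a b = word_lt w b a.
Proof.
move=> IM Ha Hb; rewrite /word_lt /flip_word Ha Hb !addbT (side_flip IM Ha Hb) eqxx.
have -> : M < a = false by case/andP: Ha; lia.
have -> : M < b = false by case/andP: Hb; lia.
by case: (ltngtP a b) => //= ?; rewrite negbK.
Qed.

(** An unflipped [b] lies on the other side or comes before all flipped positions, so every flipped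
    position compares with it alike. *)
Lemma flip_word_inout I w a d b : I < M -> in_flip I a -> in_flip I d -> ~~ in_flip I b ->
  (word_lt (flip_word I w) a b = word_lt w d b) *
  (word_lt (flip_word I w) b a = word_lt w b d).
Proof.
move=> IM Ha Hd Hb; rewrite /word_lt /flip_word (negbTE Hb) addbF (side_flip IM Ha Hd).
have aI : a <= I by case/andP: Ha.
have dI : d <= I by case/andP: Hd.
have -> : M < a = false by lia.
have -> : M < d = false by lia.
case: (leqP b I) => [bI|Ib].
  have /negbTE E := side_neq IM Hd bI Hb; rewrite E [_ == side d]eq_sym E.
  by have -> : M < b = false by lia.
have -> : a < b by lia. have -> : d < b by lia.
have -> : b < a = false by lia. by have -> : b < d = false by lia.
Qed.
End WordOrder.

(** * Reversing the order of the labels in a set *)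

Section RevIn.
Variable n : nat.
Implicit Types (s : seq 'I_n) (A : {set 'I_n}) (x y z : 'I_n).

(** The default [z] of [nth] makes this the identity off [s]. *)
Definition rev_seq s z := nth z (rev s) (index z s).

Lemma rev_seq_out s z : z \notin s -> rev_seq s z = z.
Proof. by move=> zA; rewrite /rev_seq nth_default // size_rev leqNgt index_mem. Qed.

Lemma rev_seqE s z : z \in s -> rev_seq s z = nth z s (size s - (index z s).+1).
Proof. by move=> zs; rewrite /rev_seq nth_rev // index_mem. Qed.

Lemma rev_seq_mem s z : (rev_seq s z \in s) = (z \in s).
Proof.
case zs: (z \in s); last by rewrite rev_seq_out ?zs.
have H : index z s < size s by rewrite index_mem.
have H' : size s - (index z s).+1 < size s by lia.
by rewrite rev_seqE //; apply: mem_nth.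
Qed.

Lemma index_rev_seq s z : uniq s -> z \in s ->
  index (rev_seq s z) s = size s - (index z s).+1.
Proof.
move=> us zs; have H : index z s < size s by rewrite index_mem.
have H' : size s - (index z s).+1 < size s by lia.
by rewrite rev_seqE // index_uniq.
Qed.

Lemma rev_seqK s : uniq s -> involutive (rev_seq s).
Proof.
move=> us z; case zs: (z \in s); last by rewrite !rev_seq_out ?zs.
have H : index z s < size s by rewrite index_mem.
rewrite [LHS]rev_seqE ?rev_seq_mem // index_rev_seq //.
have H' : size s - (size s - (index z s).+1).+1 < size s by lia.
rewrite (set_nth_default z) //.
by rewrite -[RHS](nth_index z zs); congr nth; lia.
Qed.

Lemma index_sorted_lt s y z : sorted (fun x y : 'I_n => x < y) s ->
  y \in s -> z \in s -> (index y s < index z s) = (y < z).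
Proof.
move=> ss.
have mono a b : a \in s -> b \in s -> index a s < index b s -> a < b.
  move=> aA bA H.
  have := sorted_ltn_nth (fun (y x z : 'I_n) => @ltn_trans y x z) a ss.
  move/(_ (index a s) (index b s)).
  by rewrite !inE !index_mem // !nth_index //; apply.
move=> yA zA; case: (ltngtP (index y _) (index z _)) => H.
- by rewrite mono.
- by have := mono _ _ zA yA H; lia.
- by rewrite -(nth_index z yA) H nth_index // ltnn.
Qed.

Lemma rev_seq_lt s y z : sorted (fun x y : 'I_n => x < y) s -> uniq s ->
  y \in s -> z \in s -> (rev_seq s y < rev_seq s z) = (z < y).
Proof.
move=> ss us yA zA.
rewrite -(@index_sorted_lt s) ?rev_seq_mem // !index_rev_seq //.
rewrite -(@index_sorted_lt s z y) //.
have Hy : index y s < size s by rewrite index_mem.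
have Hz : index z s < size s by rewrite index_mem.
by lia.
Qed.

Lemma enum_set_sorted A : sorted (fun x y : 'I_n => x < y) (enum A).
Proof.
rewrite {1}/enum_mem; apply: sorted_filter; first by move=> y x z; apply: ltn_trans.
rewrite -enumT; have := iota_ltn_sorted 0 n; rewrite -val_enum_ord.
by rewrite sorted_map.
Qed.

Definition rev_in A := rev_seq (enum A).

Lemma rev_in_out A z : z \notin A -> rev_in A z = z.
Proof. by move=> zA; rewrite /rev_in rev_seq_out // mem_enum. Qed.

Lemma rev_in_mem A z : (rev_in A z \in A) = (z \in A).
Proof. by have := rev_seq_mem (enum A) z; rewrite !mem_enum. Qed.

Lemma rev_inK A : involutive (rev_in A).
Proof. exact/rev_seqK/enum_uniq. Qed.

Lemma rev_in_lt A y z : y \in A -> z \in A -> (rev_in A y < rev_in A z) = (z < y).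
Proof.
by move=> yA zA; apply: rev_seq_lt; rewrite ?mem_enum ?enum_uniq ?enum_set_sorted.
Qed.
End RevIn.

(** * Occurrences, tries and classes of mates *)

Section Occurrence.
Variables (n M : nat).
Implicit Types (p : {ffun 'I_n -> option 'I_n}) (S : {set 'I_n}) (e z h : 'I_n).
Implicit Types (w : pred nat) (d : nat).

Definition anc p d z := iter d (parent_step p) (Some z).

Definition lab (x : option 'I_n) : nat := oapp val 0 x.

(** An occurrence is named by its last vertex, which determines the others as its ancestors. The
    first conjunct ensures that [lab] reads actual labels. *)
Definition occurs p w e :=
  [forall a : 'I_M.+3, anc p a e] &&
  [forall a : 'I_M.+3, forall b : 'I_M.+3,
     (lab (anc p a e) < lab (anc p b e)) == word_lt M w a b].

Lemma occursP p w e : reflect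
  ((forall a, a < M.+3 -> anc p a e) /\
   (forall a b, a < M.+3 -> b < M.+3 ->
      (lab (anc p a e) < lab (anc p b e)) = word_lt M w a b)) (occurs p w e).
Proof.
apply: (iffP andP) => -[H1 H2]; split.
- by move=> a aM; move/forallP/(_ (Ordinal aM)): H1.
- move=> a b aM bM.
  by move/forallP/(_ (Ordinal aM))/forallP/(_ (Ordinal bM))/eqP: H2.
- by apply/forallP => a; apply: H1.
- by apply/forallP => a; apply/forallP => b; apply/eqP/H2.
Qed.

Lemma ancD p d t e f c : anc p d e = anc p c f -> anc p (t + d) e = anc p (t + c) f.
Proof. by rewrite /anc !iterD => ->. Qed.

Lemma ancS p d e z : anc p d e = Some z -> anc p d.+1 e = p z.
Proof. by rewrite /anc iterS => ->. Qed.

Lemma word_lt_low w a b : (M < a) || (M < b) -> word_lt M w a b = (b < a).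
Proof. by rewrite /word_lt => ->. Qed.

(** By [word_lt_step] ascents and descents alternate after [h], and the step from [h] is a
    descent. *)
Lemma word_lt_no_double_ascent w d : d < M ->
  word_lt M w d.+2 d.+1 -> ~~ word_lt M w d.+1 d.
Proof.
move=> dM; rewrite (word_lt_step w dM) negbK.
case: (ltnP d.+1 M) => [dM'|]; first by rewrite word_lt_step //; lia.
by move=> Md _; have -> : M - d = 1 by lia.
Qed.

Lemma word_lt_mid w d : d < M ->
  (word_lt M w d M = odd (M - d)) * (word_lt M w M d = ~~ odd (M - d)).
Proof.
move=> dM; rewrite /word_lt /side ltnn orbF subnn dM /=.
have -> : M < d = false by lia.
by case: odd.
Qed.

Lemma word_lt_side w a b : a < M -> b < M -> odd (M - b) = ~~ odd (M - a) ->
  (word_lt M w a b = odd (M - a)) * (word_lt M w b a = ~~ odd (M - a)).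
Proof.
move=> aM bM oab; rewrite /word_lt /side oab aM bM.
have -> : (M < a) || (M < b) = false by lia.
have -> : (M < b) || (M < a) = false by lia.
by case: odd.
Qed.

(* Vertices used by a marked occurrence after its third entry; [S] is the set
   of last vertices of the marked occurrences. *)
Definition trie p S z := [exists e in S, exists d : 'I_M, anc p d e == Some z].

Lemma trieP p S z :
  reflect (exists e d, [/\ e \in S, d < M & anc p d e = Some z]) (trie p S z).
Proof.
apply: (iffP exists_inP) => [[e eS /existsP[d /eqP E]]|[e [d [eS dM E]]]].
  by exists e, d.
by exists e => //; apply/existsP; exists (Ordinal dM); apply/eqP.
Qed.

Variable I : nat.

(* Labels at flipped positions below the same vertex at position [I.+1]. *)
Definition mates p S z := [set z' | [exists e in S, exists e' in S,
  exists d : 'I_I.+1, exists d' : 'I_I.+1,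
  [&& in_flip I d, in_flip I d', anc p d e == Some z, anc p d' e' == Some z'
    & anc p I.+1 e == anc p I.+1 e']]].

Lemma matesP p S z z' : reflect
  (exists e e' d d', [/\ e \in S, in_flip I d & anc p d e = Some z] /\
     [/\ e' \in S, in_flip I d', anc p d' e' = Some z' & anc p I.+1 e = anc p I.+1 e'])
  (z' \in mates p S z).
Proof.
rewrite inE; apply: (iffP exists_inP).
  case=> e eS /exists_inP[e' eS' /existsP[d /existsP[d' /and5P[fd fd' /eqP ? /eqP ? /eqP ?]]]].
  by exists e, e', d, d'.
case=> e [e' [d [d' [[eS fd E] [eS' fd' E' U]]]]].
exists e => //; apply/exists_inP; exists e' => //.
have dI : d < I.+1 by case/andP: fd.
have dI' : d' < I.+1 by case/andP: fd'.
apply/existsP; exists (Ordinal dI); apply/existsP; exists (Ordinal dI').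
by rewrite fd fd' E E' U !eqxx.
Qed.

(** A label at no flipped position has no mates and stays fixed. *)
Definition rho p S z := rev_in (mates p S z) z.

(** Conjugation by [rho] on the trie; elsewhere parent labels are kept, so that what hangs below a
    label stays attached to it. *)
Definition flip_par p S : {ffun 'I_n -> option 'I_n} :=
  [ffun z => if trie p S z then omap (rho p S) (p (rho p S z)) else p z].

Definition flip_ends p S : {set 'I_n} := rho p S @: S.

(** * The flip as an involution on marked forests *)

Section Flip.
Variables (p : {ffun 'I_n -> option 'I_n}) (S : {set 'I_n}) (w : pred nat).
Hypothesis IM : I < M.
Hypothesis occ : {in S, forall e, occurs p w e}.

Local Notation p' := (flip_par p S).
Local Notation S' := (flip_ends p S).
Local Notation r := (rho p S).
Local Notation w' := (flip_word I w).

Lemma anc_some d e : e \in S -> d < M.+3 -> exists z, anc p d e = Some z.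
Proof.
by move=> /occ/occursP[H _] /H; case: (anc p d e) => // z _; exists z.
Qed.

Lemma anc_lt a b e : e \in S -> a < M.+3 -> b < M.+3 ->
  (lab (anc p a e) < lab (anc p b e)) = word_lt M w a b.
Proof. by move=> /occ/occursP[_ H] aM bM; apply: H. Qed.

(** Otherwise the double ascent at the first three entries of the occurrence of [e'] would reappear
    at later entries of that of [e]. *)
Lemma level_lt_false d d' e e' : e \in S -> e' \in S -> d < d' -> d' <= M ->
  anc p d e = anc p d' e' -> False.
Proof.
(* [q] is the position, in the occurrence of [e], of the third entry of the occurrence of [e']. *)
move=> eS eS' dd dM E; pose q := M - (d' - d).
have chain j : anc p (q + j) e = anc p (M + j) e'.
  have -> : q + j = (M - d' + j) + d by rewrite /q; lia.
  have -> : M + j = (M - d' + j) + d' by lia.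
  exact: ancD.
have qM : q < M by rewrite /q; lia.
have := @word_lt_no_double_ascent w q qM.
rewrite -!(anc_lt eS) ?ltnS //; try lia.
have := chain 0; have := chain 1; have := chain 2; rewrite !addn0 !addn1 !addn2.
by move=> -> -> ->; rewrite !(anc_lt eS') ?word_lt_low //; lia.
Qed.

Lemma level_unique d d' e e' : e \in S -> e' \in S -> d <= M -> d' <= M ->
  anc p d e = anc p d' e' -> d = d'.
Proof.
move=> eS eS' dM dM' E; case: (ltngtP d d') => // H; exfalso.
  exact: (level_lt_false eS eS' H dM' E).
exact: (level_lt_false eS' eS H dM (esym E)).
Qed.

Lemma anc_above d t e e' : anc p d e = anc p d e' -> d <= t -> anc p t e = anc p t e'.
Proof. by move=> E dt; rewrite -(subnK dt); apply: ancD. Qed.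

Lemma in_flip_lt d : in_flip I d -> d < M.
Proof. by case/andP => dI _; apply: leq_ltn_trans IM. Qed.

Lemma in_flip_le d : in_flip I d -> d <= I.
Proof. by case/andP. Qed.

Lemma mates_refl d e z : e \in S -> in_flip I d -> anc p d e = Some z -> z \in mates p S z.
Proof. by move=> eS fd E; apply/matesP; exists e, e, d, d. Qed.

Lemma mates_sym z z' : z' \in mates p S z -> z \in mates p S z'.
Proof.
case/matesP=> e [e' [d [d' [[? ? ?] [? ? ? ?]]]]].
by apply/matesP; exists e', e, d', d.
Qed.

(** The middle label has a single level by [level_unique], so both pairs hang below the same vertex
    at [I.+1]. *)
Lemma mates_trans z1 z2 z3 :
  z2 \in mates p S z1 -> z3 \in mates p S z2 -> z3 \in mates p S z1.
Proof.
case/matesP=> e [e' [d [d' [[eS fd E] [eS' fd' E' U]]]]].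
case/matesP=> f [f' [c [c' [[fS fc F] [fS' fc' F' V]]]]].
apply/matesP; exists e, f', d, c'; split; split=> //.
have H : anc p d' e' = anc p c f by rewrite E' F.
have dc : d' = c := level_unique eS' fS (ltnW (in_flip_lt fd')) (ltnW (in_flip_lt fc)) H.
rewrite U -V; rewrite dc in H; apply: anc_above H _.
exact/leqW/in_flip_le.
Qed.

Lemma mates_eq z z' : z' \in mates p S z -> mates p S z' = mates p S z.
Proof.
move=> H; apply/setP => x; apply/idP/idP => K; first exact: mates_trans K.
exact: mates_trans (mates_sym H) K.
Qed.

Lemma mates_self z z' : z' \in mates p S z -> z \in mates p S z.
Proof. by move=> H; apply: mates_trans H (mates_sym H). Qed.

Lemma rho_mem z : (r z \in mates p S z) = (z \in mates p S z).
Proof. exact: rev_in_mem. Qed.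

Lemma rhoK : involutive r.
Proof.
move=> z; case zz: (z \in mates p S z).
  have H : r z \in mates p S z by rewrite rev_in_mem.
  by rewrite {1}/rho (mates_eq H) rev_inK.
have rz : r z = z by apply: rev_in_out; rewrite zz.
by rewrite !rz.
Qed.

Lemma rho_fix d e z : e \in S -> d <= M -> ~~ in_flip I d -> anc p d e = Some z -> r z = z.
Proof.
move=> eS dM fd E; apply/rev_in_out/negP => /matesP[f [_ [c [_ [[fS fc F] _]]]]].
have H : anc p d e = anc p c f by rewrite E F.
by move: fd; rewrite (level_unique eS fS dM (ltnW (in_flip_lt fc)) H) fc.
Qed.

(** Mates share the ancestor at [I.+1], hence everything above it; their own positions may
    differ. *)
Lemma rho_flip d e z : e \in S -> in_flip I d -> anc p d e = Some z ->
  exists e' d', [/\ e' \in S, in_flip I d', anc p d' e' = Some (r z) &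
    forall t, I < t -> anc p t e = anc p t e'].
Proof.
move=> eS fd E; have := mates_refl eS fd E; rewrite -rev_in_mem.
case/matesP=> f [f' [c [c' [[fS fc F] [fS' fc' F' V]]]]].
exists f', c'; split=> // t It; apply: anc_above It; rewrite -V.
have H : anc p d e = anc p c f by rewrite E F.
have dc : d = c := level_unique eS fS (ltnW (in_flip_lt fd)) (ltnW (in_flip_lt fc)) H.
rewrite -dc in H; apply: anc_above H _; exact/leqW/in_flip_le.
Qed.

(** Covers fixed labels as well. The parity clause is what keeps ascent tops ascent tops. *)
Lemma rho_anc d e z : e \in S -> d <= M -> anc p d e = Some z ->
  exists e' d', [/\ e' \in S, anc p d' e' = Some (r z) &
    forall t, I < t -> anc p t e = anc p t e'] /\
    [/\ odd d' = odd d, d' <= M & d < M -> d' < M].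
Proof.
move=> eS dM E; case fd: (in_flip I d).
  have [e' [d' [eS' fd' E' U]]] := rho_flip eS fd E.
  have lt := in_flip_lt fd'.
  exists e', d'; split=> //; split=> //; last exact: ltnW.
  by case/andP: fd' => _ /eqP ->; case/andP: fd => _ /eqP ->.
by exists e, d; split=> //; split=> //; rewrite (rho_fix eS dM (negbT fd) E).
Qed.

Lemma trie_rho z : trie p S (r z) = trie p S z.
Proof.
have imp x : trie p S x -> trie p S (r x).
  case/trieP=> e [d [eS dM E]].
  have [e' [d' [[eS' E' _] [_ _ dM']]]] := rho_anc eS (ltnW dM) E.
  by apply/trieP; exists e', d'; rewrite dM'.
by apply/idP/idP => [/imp|/imp //]; rewrite rhoK.
Qed.

(** Positions below [M] lie in the trie, where the parent map is conjugated. *)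
Lemma flip_anc d e : e \in S -> d <= M -> anc p' d (r e) = omap r (anc p d e).
Proof.
move=> eS; elim: d => [//|d IH] dM.
have [z E] := anc_some eS (leqW (leqW (leqW dM))).
rewrite (ancS E) /anc iterS -/(anc p' d _) IH ?(ltnW dM) // E /= ffunE trie_rho rhoK.
by have -> : trie p S z by apply/trieP; exists e, d.
Qed.

(** The third entry is at no later position of any marked occurrence, by [level_lt_false], so the
    flip changes neither it nor its parent label. *)
Lemma flip_anc_root e h : e \in S -> anc p M e = Some h ->
  [/\ r h = h, ~~ trie p S h & anc p' M (r e) = Some h].
Proof.
move=> eS E.
have rh : r h = h.
  apply: (rho_fix eS (leqnn M) _ E); rewrite /in_flip leqNgt IM //.
split=> //; last by rewrite flip_anc // E /= rh.
apply/negP => /trieP[f [d [fS dM F]]].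
by apply: (level_lt_false fS eS dM (leqnn M)); rewrite E F.
Qed.

Lemma flip_anc_top e : e \in S -> anc p' M.+1 (r e) = anc p M.+1 e.
Proof.
move=> eS; have [h E] := anc_some eS (leqW (leqW (leqnn M.+1))).
have [rh th E'] := flip_anc_root eS E.
by rewrite (ancS E) (ancS E') ffunE (negbTE th).
Qed.

(** [r za] need not lie on the occurrence of [e], so the comparison passes to an occurrence [e']
    that contains it. *)
Lemma flip_lt_inout a b e za zb : e \in S -> in_flip I a -> b <= M -> ~~ in_flip I b ->
  anc p a e = Some za -> anc p b e = Some zb ->
  ((r za < zb) = word_lt M w' a b) /\ ((zb < r za) = word_lt M w' b a).
Proof.
move=> eS fa bM fb Ea Eb.
have [e' [a' [eS' fa' Ea' U]]] := rho_flip eS fa Ea.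
rewrite !(flip_word_inout w IM fa fa' fb).
have aM := in_flip_lt fa; have aM' := in_flip_lt fa'.
(* Before [I] the two occurrences share the vertex at [b]; after it, [b] is on the other side and
   the shared [h] separates the labels. *)
case: (ltnP I b) => Ib.
  have Eb' := Eb; rewrite (U _ Ib) in Eb'.
  by rewrite -!(anc_lt eS') ?ltnS ?Ea' ?Eb' //; lia.
have bM' : b < M by lia.
have [h Eh] := anc_some eS (leqW (leqW (leqnn M.+1))).
have Eh' := Eh; rewrite (U _ IM) in Eh'.
have oab : odd (M - b) = ~~ odd (M - a').
  by move: fa' fb; rewrite /in_flip; lia.
have [-> ->] := word_lt_side w aM' bM' oab.
have [aM3 bM3 M3] : [/\ a' < M.+3, b < M.+3 & M < M.+3] by split; lia.
have [] := word_lt_mid w aM'; have [] := word_lt_mid w bM'; rewrite oab.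
rewrite -(anc_lt eS bM3 M3) -(anc_lt eS M3 bM3).
rewrite -(anc_lt eS' aM3 M3) -(anc_lt eS' M3 aM3).
by rewrite Eb Eh Eh' Ea' /=; case: (odd _) => /=; lia.
Qed.

(** Two flipped labels of one occurrence are mates, so [rho] reverses them just as the flipped word
    requires. *)
Lemma flip_anc_lt a b e : e \in S -> a <= M -> b <= M ->
  (lab (anc p' a (r e)) < lab (anc p' b (r e))) = word_lt M w' a b.
Proof.
move=> eS aM bM; rewrite !flip_anc //.
have [za Ea] := anc_some eS (leqW (leqW aM)).
have [zb Eb] := anc_some eS (leqW (leqW bM)).
rewrite Ea Eb /=.
case fa: (in_flip I a); case fb: (in_flip I b).
- have ab : zb \in mates p S za by apply/matesP; exists e, e, a, b.
  rewrite (flip_word_in w IM fa fb) /rho (mates_eq ab) rev_in_lt //; last exact: mates_self ab.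
  by rewrite -(anc_lt eS) ?ltnS ?Ea ?Eb //; lia.
- rewrite (rho_fix eS bM (negbT fb) Eb).
  by have [] := flip_lt_inout eS fa bM (negbT fb) Ea Eb.
- rewrite (rho_fix eS aM (negbT fa) Ea).
  by have [] := flip_lt_inout eS fb aM (negbT fa) Eb Ea.
- rewrite (rho_fix eS aM (negbT fa) Ea) (rho_fix eS bM (negbT fb) Eb).
  rewrite flip_word_out ?fa ?fb //.
  by rewrite -(anc_lt eS) ?ltnS ?Ea ?Eb //; lia.
Qed.

(** [r z] lies on a marked occurrence with the same second entry, which is below all that follow
    it. *)
Lemma flip_anc_low d e : e \in S -> d <= M ->
  lab (anc p' M.+1 (r e)) < lab (anc p' d (r e)).
Proof.
move=> eS dM; have [z E] := anc_some eS (leqW (leqW dM)).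
have [e' [d' [[eS' E' U] [_ dM' _]]]] := rho_anc eS dM E.
rewrite flip_anc_top // flip_anc // E -[omap _ _]/(Some (r z)) -E' (U M.+1 (leqW IM)).
have dM3 : d' < M.+3 by lia.
by rewrite (anc_lt eS' (leqnSn M.+2 : M.+1 < M.+3) dM3) word_lt_low ?ltnS ?dM' ?leqnn.
Qed.

(* The parent of the second entry changes when that vertex also lies in a trie;
   it is then an ascent top of its new occurrence as well. *)
Lemma flip_anc_apex e : e \in S ->
  exists2 z, anc p' M.+2 (r e) = Some z & z < lab (anc p' M.+1 (r e)).
Proof.
move=> eS; have [v Ev] := anc_some eS (leqnSn M.+2 : M.+1 < M.+3).
have [u Eu] := anc_some eS (leqnn M.+3).
have Ev' := flip_anc_top eS; rewrite Ev in Ev'.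
have uv : u < v.
  have := @anc_lt M.+2 M.+1 e eS; rewrite Eu Ev word_lt_low ?ltnS ?leqnSn ?orbT //=.
  by move=> ->.
have pv : p v = Some u by rewrite -(ancS Ev) Eu.
rewrite (ancS Ev') Ev' ffunE /=; case: ifP => [/trieP[e2 [d2 [eS2 dM2 E2]]]|_]; last by exists u.
have odd2 : ~~ odd (M - d2).
  rewrite -(word_lt_step w dM2) -(anc_lt eS2) ?ltnS ?(ltnW dM2) //; try lia.
  by rewrite (ancS E2) E2 pv.
have [e3 [d3 [[eS3 E3 _] [odd3 _ /(_ dM2) dM3]]]] := rho_anc eS2 (ltnW dM2) E2.
have F3 : anc p' d3 (r e3) = Some v by rewrite flip_anc ?(ltnW dM3) // E3 /= rhoK.
have := flip_anc_lt eS3 dM3 (ltnW dM3).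
rewrite word_lt_step // F3 flip_anc // (ancS E3).
have [x Ex] : exists x, p (r v) = Some x.
  have [x Ex] := anc_some eS3 (leqW (leqW dM3) : d3.+1 < M.+3).
  by exists x; rewrite -(ancS E3).
rewrite Ex /= => H; exists (r x) => //.
by rewrite H; lia.
Qed.

Lemma flip_occurs e : e \in S -> occurs p' w' (r e).
Proof.
move=> eS; have [u Eu uv] := flip_anc_apex eS.
have [v Ev] := anc_some eS (leqnSn M.+2 : M.+1 < M.+3).
rewrite -(flip_anc_top eS) in Ev.
have low d : d <= M -> v < lab (anc p' d (r e)).
  by move=> dM; have := flip_anc_low eS dM; rewrite Ev.
have lv : lab (anc p' M.+1 (r e)) = v by rewrite Ev.
rewrite lv in uv.
have lu : lab (anc p' M.+2 (r e)) = u by rewrite Eu.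
have Wl a b : M < a -> word_lt M w' a b = (b < a).
  by move=> Ma; apply: word_lt_low; rewrite Ma.
have Wr a b : M < b -> word_lt M w' a b = (b < a).
  by move=> Mb; apply: word_lt_low; rewrite Mb orbT.
have cases d : d < M.+3 -> [\/ d <= M, d = M.+1 | d = M.+2].
  by case: (ltngtP d M.+1) => [?|?|->] ?; [constructor 1|constructor 3|constructor 2]; lia.
apply/occursP; split=> [a /cases[aM|->|->]|a b /cases[aM|->|->] /cases[bM|->|->]].
- have [z E] := anc_some eS (leqW (leqW aM)).
  by rewrite flip_anc // E.
- by rewrite Ev.
- by rewrite Eu.
- exact: flip_anc_lt.
- by have := low _ aM; rewrite lv Wr //; lia.
- by have := low _ aM; rewrite lu Wr //; lia.
- by have := low _ bM; rewrite lv Wl //; lia.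
- by rewrite lv Wl ?ltnn.
- by rewrite lv lu Wl //; lia.
- by have := low _ bM; rewrite lu Wl //; lia.
- by rewrite lv lu Wl // uv leqnn.
- by rewrite lu Wl ?ltnn.
Qed.

Lemma flip_trie z : trie p' S' z = trie p S z.
Proof.
rewrite -trie_rho; apply/trieP/trieP => -[e [d [eS dM E]]].
  case/imsetP: eS E => {}e eS ->; rewrite flip_anc ?(ltnW dM) // => E.
  exists e, d; split=> //; case: (anc p d e) E => //= y [<-].
  by rewrite rhoK.
exists (r e), d; split=> //; first exact: imset_f.
by rewrite flip_anc ?(ltnW dM) // E /= rhoK.
Qed.

Lemma omap_rhoK : involutive (omap r).
Proof. by case=> //= z; rewrite rhoK. Qed.

(** With the trie and the classes unchanged, a second flip applies the same [rho] and undoes the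
    first. *)
Lemma flip_mates z : mates p' S' z = mates p S z.
Proof.
apply/setP => z'; apply/idP/idP.
  case/matesP=> _ [_ [d [d' [[/imsetP[e eS ->] fd E] [/imsetP[e' eS' ->] fd' E' U]]]]].
  have H : r z' \in mates p S (r z).
    have dM := in_flip_lt fd; have dM' := in_flip_lt fd'.
    rewrite !flip_anc ?(ltnW dM) ?(ltnW dM') // in E E' U.
    apply/matesP; exists e, e', d, d'; split; split=> //.
    - by rewrite -[LHS]omap_rhoK E.
    - by rewrite -[LHS]omap_rhoK E'.
    - exact: (inv_inj omap_rhoK).
  have H1 := mates_self H; have H2 := mates_self (mates_sym H).
  have K1 : z \in mates p S (r z) by have := rho_mem (r z); rewrite rhoK => ->.
  have K2 : z' \in mates p S (r z') by have := rho_mem (r z'); rewrite rhoK => ->.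
  exact: mates_trans (mates_trans (mates_sym K1) H) K2.
case/matesP=> e [e' [d [d' [[eS fd E] [eS' fd' E' U]]]]].
have [f [c [fS fc F V]]] := rho_flip eS fd E.
have [f' [c' [fS' fc' F' V']]] := rho_flip eS' fd' E'.
apply/matesP; exists (r f), (r f'), c, c'; split; split=> //; try exact: imset_f.
- by rewrite flip_anc ?(ltnW (in_flip_lt _)) // F /= rhoK.
- by rewrite flip_anc ?(ltnW (in_flip_lt _)) // F' /= rhoK.
- by rewrite !flip_anc // -V // -V' // U.
Qed.

Lemma flip_rho : rho p' S' =1 r.
Proof. by move=> z; rewrite /rho flip_mates. Qed.

Lemma flip_parK : flip_par p' S' = p.
Proof.
apply/ffunP => z; rewrite ffunE flip_trie flip_rho.
case tz: (trie p S z); last by rewrite ffunE tz.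
by rewrite (eq_omap flip_rho) ffunE trie_rho tz rhoK omap_rhoK.
Qed.

Lemma flip_endsK : flip_ends p' S' = S.
Proof.
rewrite /flip_ends (eq_imset _ flip_rho) -imset_comp -[RHS]imset_id.
by apply: eq_imset => z /=; rewrite rhoK.
Qed.

Lemma card_flip_ends : #|S'| = #|S|.
Proof. exact/card_imset/(inv_inj rhoK). Qed.

(* Inside a trie both [p] and [p'] lead to the same third entry [h] and then to
   the same parent of [h], so [p'] has no cycle either. *)
Lemma flip_reaches_root N z : anc p N z = None -> exists m, anc p' m z = None.
Proof.
have [k] := ubnP N; elim: k N z => // k IH [//|N] z; rewrite ltnS => Nk E.
case tz: (trie p S z); last first.
  have step q : anc q N.+1 z = iter N (parent_step q) (q z) by rewrite /anc iterSr.
  case pz: (p z) => [y|]; last by exists 1; rewrite /anc /= ffunE tz pz.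
  rewrite step pz in E; have [m Em] := IH _ _ Nk E.
  by exists m.+1; rewrite /anc iterSr /= ffunE tz pz.
have [e [d [eS dM Ez]]] := trieP _ _ _ tz.
have [h Eh] := anc_some eS (leqW (leqW (leqnn M.+1))).
have hz : anc p (M - d) z = Some h.
  by rewrite -Eh -{2}(subnK (ltnW dM)) /anc iterD -/(anc p d e) Ez.
have NM : M - d < N.+1.
  rewrite ltnNge; apply/negP => le; move: hz.
  by rewrite -(subnK le) /anc iterD -/(anc p N.+1 z) E iter_fix.
(* Since [d < M], the vertex [h] is strictly closer to the root than [z], and induction applies. *)
have [m Em] : exists m, anc p' m h = None.
  apply: (IH (N.+1 - (M - d))); first by lia.
  by rewrite /anc -hz /anc -iterD subnK // ltnW.
have [e' [d' [[eS' E' U] [_ dM' _]]]] := rho_anc eS (ltnW dM) Ez.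
have Eh' := Eh; rewrite (U _ IM) in Eh'.
have [_ _ F] := flip_anc_root eS' Eh'.
have G : anc p' d' (r e') = Some z by rewrite flip_anc // E' /= rhoK.
exists (m + (M - d')); rewrite -Em /anc iterD; congr iter.
by rewrite -F -{2}(subnK dM') /anc iterD -/(anc p' d' _) G.
Qed.

End Flip.
End Occurrence.

(** * Inclusion-exclusion over marked forests *)

Section Counting.
Variables (n M : nat).
Implicit Types (p : {ffun 'I_n -> option 'I_n}) (w : pred nat).

(** Pigeonhole: the vertices on a shortest path to [None], together with [None], are distinct, so
    [n] steps suffice. *)
Lemma is_forestP p : reflect (forall z, exists m, anc p m z = None) (is_forest p).
Proof.
apply: (iffP forallP) => [H z|H z]; first by exists n; apply/eqP/H.
pose P m := anc p m z == None.
have [m /eqP Em min] : exists2 m, P m & forall j, P j -> m <= j.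
  have exP : exists m, P m by have [m E] := H z; exists m; apply/eqP.
  by exists (ex_minn exP); case: ex_minnP.
suff le : m < n.+1.
  have : anc p ((n - m) + m) z = None by rewrite /anc iterD -/(anc p m z) Em iter_fix.
  by rewrite subnK // => /eqP.
have inj : injective (fun i : 'I_m.+1 => anc p i z).
  have lt_neq (i j : 'I_m.+1) : i < j -> anc p i z <> anc p j z.
    move=> ij E; have jm : j <= m := ltn_ord j.
    have /eqP/min : anc p (m - j + i) z = None.
      by rewrite (ancD (m - j) E) subnK.
    by lia.
  move=> i j E; apply/val_inj => /=; case: (ltngtP i j) => // ij; exfalso.
    exact: lt_neq ij E.
  exact: lt_neq ij (esym E).
by have := leq_card _ inj; rewrite card_option !card_ord.
Qed.

Definition occurrence_ends p w := [set e | occurs M p w e].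

(** [b] is the sign in inclusion-exclusion, kept as a parity to stay within [nat]. *)
Definition marked w (b : bool) :=
  [set c : {ffun 'I_n -> option 'I_n} * {set 'I_n} |
    [&& is_forest c.1, c.2 \subset occurrence_ends c.1 w & odd #|c.2| == b]].

(** Among positions at most [M], [h] is alone on its side, so the word is never read at [M]
    itself. *)
Lemma word_lt_ext w1 w2 a b : (forall j, j < M -> w1 j = w2 j) ->
  word_lt M w1 a b = word_lt M w2 a b.
Proof.
move=> E; rewrite /word_lt; case: ifP => // /negbT; rewrite negb_or -!leqNgt => /andP[aM bM].
have sideM d : d < M -> (side M d == side M M) = false.
  by rewrite /side subnn ltnn /= => ->; case: odd.
case: eqP => // sab; case: (ltngtP b a) => //= ab.
  apply: E; rewrite ltn_neqAle aM andbT; apply/eqP => aE.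
  by have := sideM b; rewrite -sab aE eqxx -{1}aE ab => /(_ isT).
congr (~~ _); apply: E; rewrite ltn_neqAle bM andbT; apply/eqP => bE.
by have := sideM a; rewrite sab bE eqxx -{1}bE ab => /(_ isT).
Qed.

Lemma marked_ext w1 w2 b : (forall j, j < M -> w1 j = w2 j) -> marked w1 b = marked w2 b.
Proof.
move=> E; apply/setP => c; rewrite !inE.
suff -> : occurrence_ends c.1 w1 = occurrence_ends c.1 w2 by [].
apply/setP => e; rewrite !inE /occurs; congr (_ && _).
by apply: eq_forallb => i; apply: eq_forallb => j; rewrite (word_lt_ext _ _ E).
Qed.

Lemma leq_card_marked_flip I w b : I < M -> #|marked w b| <= #|marked (flip_word I w) b|.
Proof.
move=> IM; pose F (c : {ffun 'I_n -> option 'I_n} * {set 'I_n}) :=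
  (flip_par M I c.1 c.2, flip_ends I c.1 c.2).
have occ p (S : {set 'I_n}) : S \subset occurrence_ends p w -> {in S, forall e, occurs M p w e}.
  by move=> /subsetP sub e /sub; rewrite inE.
have inj : {in marked w b &, injective F}.
  apply: (can_in_inj (g := F)) => -[p S]; rewrite inE /= => /and3P[_ /occ o _].
  by rewrite /F /= (flip_parK IM o) (flip_endsK IM o).
rewrite -(card_in_imset inj); apply/subset_leq_card/subsetP => c' /imsetP[[p S]].
rewrite inE /= => /and3P[/is_forestP fp /occ o ob] ->; rewrite inE /= (card_flip_ends IM o) ob andbT.
apply/andP; split.
  by apply/is_forestP => z; have [m E] := fp z; apply: flip_reaches_root IM o _ _ E.
apply/subsetP => _ /imsetP[e eS ->]; rewrite inE; exact: flip_occurs.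
Qed.

Lemma card_marked_flip I w b : I < M -> #|marked (flip_word I w) b| = #|marked w b|.
Proof.
move=> IM; apply/eqP; rewrite eqn_leq leq_card_marked_flip // andbT.
have := leq_card_marked_flip (flip_word I w) b IM.
by rewrite (@marked_ext (flip_word I (flip_word I w)) w) // => j _; apply: flip_wordK.
Qed.

(** A flip at [t] leaves the positions above [t] alone, so the word can be corrected from position
    [M.-1] down to 0. *)
Lemma card_marked w1 w2 b : #|marked w1 b| = #|marked w2 b|.
Proof.
suff agree t : forall w, (forall j, t <= j -> j < M -> w j = w2 j) ->
    #|marked w b| = #|marked w2 b|.
  by apply: (agree M) => j le lt; lia.
elim: t => [|t IH] w E; first by congr #|pred_of_set _|; apply: marked_ext => j; apply: E.
case: (ltnP t M) => tM; last by apply: IH => j tj jM; lia.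
case: (eqVneq (w t) (w2 t)) => wt.
  by apply: IH => j; rewrite leq_eqVlt => /orP[/eqP <- //|]; apply: E.
rewrite -(card_marked_flip w b tM); apply: IH => j; rewrite leq_eqVlt => /orP[/eqP <- _|tj jM].
  by rewrite /flip_word /in_flip leqnn eqxx; case: (w t) (w2 t) wt => -[].
by rewrite /flip_word /in_flip leqNgt tj addbF E.
Qed.

Lemma card_parity_subsets (T : finType) (E : {set T}) :
  #|[set S : {set T} | S \subset E & odd #|S| == false]| =
  (E == set0) + #|[set S : {set T} | S \subset E & odd #|S| == true]|.
Proof.
case: (set_0Vmem E) => [->|[x xE]].
  have -> : [set S : {set T} | S \subset set0 & odd #|S| == false] = [set set0].
    apply/setP => S; rewrite !inE subset0.
    by case: eqP => // ->; rewrite cards0.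
  have -> : [set S : {set T} | S \subset set0 & odd #|S| == true] = set0.
    apply/setP => S; rewrite !inE subset0.
    by case: eqP => // ->; rewrite cards0.
  by rewrite cards1 cards0 eqxx.
have -> : (E == set0) = false by apply/negbTE/set0Pn; exists x.
(* Toggling a fixed element of [E] pairs even with odd subsets. *)
pose tog (S : {set T}) := if x \in S then S :\ x else x |: S.
have togK : involutive tog.
  move=> S; rewrite /tog; case xS: (x \in S); first by rewrite !inE eqxx /= setD1K.
  by rewrite setU11 setU1K ?xS.
have odd_tog S : odd #|tog S| = ~~ odd #|S|.
  rewrite /tog; case xS: (x \in S); last by rewrite cardsU1 xS.
  by rewrite [#|S|](cardsD1 x) xS /= negbK.
have sub_tog S : (tog S \subset E) = (S \subset E).
  rewrite /tog; case: ifP => xS; last by rewrite subUset sub1set xE.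
  by rewrite -[in RHS](setD1K xS) subUset sub1set xE.
rewrite add0n -(card_imset _ (inv_inj togK)); congr #|pred_of_set _|.
apply/setP => S; rewrite -[S in LHS]togK (mem_imset _ _ (inv_inj togK)) !inE.
by rewrite sub_tog odd_tog; case: odd.
Qed.

Definition avoiding w := [set p | is_forest p & occurrence_ends p w == set0].

Lemma card_marked_sum w b : #|marked w b| =
  \sum_(p | is_forest p) #|[set S : {set 'I_n} | S \subset occurrence_ends p w & odd #|S| == b]|.
Proof.
rewrite -sum1_card; under [RHS]eq_bigr do rewrite -sum1_card.
by rewrite pair_big_dep; apply: eq_bigl => c; rewrite !inE.
Qed.

(** For each forest, even and odd sets of marks cancel unless there is no occurrence. *)
Lemma card_avoiding_marked w : #|marked w false| = #|avoiding w| + #|marked w true|.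
Proof.
rewrite !card_marked_sum; under eq_bigr do rewrite card_parity_subsets.
rewrite big_split /=; congr (_ + _).
rewrite -sum1_card [RHS](eq_bigl (fun p => is_forest p && (occurrence_ends p w == set0))).
  by rewrite -big_mkcondr.
by move=> p; rewrite inE.
Qed.

Lemma card_avoiding w1 w2 : #|avoiding w1| = #|avoiding w2|.
Proof.
apply/(@addIn #|marked w1 true|).
rewrite -card_avoiding_marked (card_marked w1 w2 true) -(card_avoiding_marked w2).
exact: card_marked.
Qed.

(** Pattern entries are read from the root side, positions from the last vertex; [rev_ord]
    translates. *)
Lemma occurs_cinstance p (pi : 'S_M.+3) w :
  (forall i j : 'I_M.+3, (pi i < pi j) = word_lt M w (rev_ord i) (rev_ord j)) ->
  cavoids p pi = (occurrence_ends p w == set0).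
Proof.
move=> Epi; rewrite /cavoids -[RHS]negbK; congr (~~ _); apply/existsP/set0Pn.
  case=> v /andP[/forallP par /forallP ord]; exists (v ord_max).
  have chain (d : nat) (i : 'I_M.+3) : d = rev_ord i -> anc p d (v ord_max) = Some (v i).
    elim: d i => [|d IH] i Ei.
      by congr (Some (v _)); apply/val_inj; move: Ei (ltn_ord i) => /=; lia.
    have lt : i.+1 < M.+3 by move: Ei => /=; lia.
    have /IH/ancS -> : d = rev_ord (Ordinal lt) by move: Ei => /=; lia.
    by move/forallP/(_ (Ordinal lt))/implyP/(_ (eqxx _))/eqP: (par i).
  have chain' (i : 'I_M.+3) : anc p i (v ord_max) = Some (v (rev_ord i)).
    by apply: chain; rewrite rev_ordK.
  rewrite inE; apply/andP; split; first by apply/forallP => i; rewrite chain'.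
  apply/forallP => i; apply/forallP => j; rewrite !chain' /=.
  by move/forallP/(_ (rev_ord j))/eqP: (ord (rev_ord i)) => ->; rewrite Epi !rev_ordK.
case=> e; rewrite inE => /occursP[some ord].
(* The default [e] is never reached, since all these ancestors exist. *)
exists [ffun i => odflt e (anc p (rev_ord i) e)].
have chain (i : 'I_M.+3) : Some (odflt e (anc p (rev_ord i) e)) = anc p (rev_ord i) e.
  by have := some _ (ltn_ord (rev_ord i)); case: anc.
apply/andP; split; apply/forallP => i; apply/forallP => j; rewrite !ffunE.
  apply/implyP => /eqP ij.
  have E : rev_ord i = (rev_ord j).+1 :> nat.
    by move: ij (ltn_ord j) => /=; lia.
  by rewrite chain E -(ancS (esym (chain j))).
have labE (h : 'I_M.+3) : lab (anc p (rev_ord h) e) = odflt e (anc p (rev_ord h) e).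
  by rewrite -{1}chain.
by rewrite Epi -ord // !labE.
Qed.

End Counting.

(** * Permutations from strict total orders, and the patterns of words *)

Section Rank.
Variables (k : nat) (lt : rel 'I_k).
Hypotheses (irr : irreflexive lt) (trans : transitive lt).
Hypothesis total : forall i j, i <> j -> lt i j || lt j i.

(** The value at [i] is the number of elements below [i]. *)
Lemma rank_perm : exists pi : 'S_k, forall i j, (pi i < pi j) = lt i j.
Proof.
have rankP i : #|[set j | lt j i]| < k.
  rewrite -[X in _ < X]card_ord -cardsT; apply: proper_card.
  by apply/properP; split; [exact: subsetT | exists i; rewrite !inE ?irr].
pose rank i := Ordinal (rankP i).
have mono i j : lt i j -> rank i < rank j.
  move=> ij; apply/proper_card/properP; split; last by exists i; rewrite !inE ?irr.
  by apply/subsetP => h; rewrite !inE => hi; apply: trans ij.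
have rankE i j : (rank i < rank j) = lt i j.
  apply/idP/idP => [|/mono //]; case: (eqVneq i j) => [->|/eqP ij]; first by rewrite ltnn.
  by case/orP: (total ij) => // /mono; lia.
have inj : injective rank.
  move=> i j /(congr1 val) E; apply/eqP/negPn/negP => /eqP /total.
  by rewrite -!rankE /= in E *; lia.
by exists (perm inj) => i j; rewrite !permE rankE.
Qed.

End Rank.

(** Stated with boolean quantifiers so that [xchoose] can pick a pattern. *)
Lemma word_pattern M w :
  exists pi : 'S_M.+3,
    [forall i : 'I_M.+3, forall j : 'I_M.+3,
       (pi i < pi j) == word_lt M w (rev_ord i) (rev_ord j)].
Proof.
have [||i j ij|pi H] := @rank_perm M.+3 (fun i j => word_lt M w (rev_ord i) (rev_ord j)).
- by move=> i; apply: word_lt_irr.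
- by move=> i j h; apply: word_lt_trans.
- by apply: word_lt_total => /val_inj/rev_ord_inj.
- by exists pi; apply/forallP => i; apply/forallP => j; rewrite H.
Qed.

Definition pattern M w : 'S_M.+3 := xchoose (word_pattern M w).

Lemma patternE M w (i j : 'I_M.+3) :
  (pattern M w i < pattern M w j) = word_lt M w (rev_ord i) (rev_ord j).
Proof. by move: (xchooseP (word_pattern M w)) => /forallP/(_ i)/forallP/(_ j)/eqP. Qed.

Lemma pattern_equiv M w1 w2 : cforest_wilf_equiv (pattern M w1) (pattern M w2).
Proof.
have num n w : num_cavoid n (pattern M w) = #|avoiding n M w|.
  rewrite /num_cavoid; congr #|pred_of_set _|; apply/setP => p; rewrite !inE.
  by rewrite (occurs_cinstance p (@patternE M w)).
by move=> n; rewrite !num; apply: card_avoiding.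
Qed.

(** * Complementation of patterns *)

Section Complement.
Variable k : nat.
Implicit Types (pi : 'S_k).

Definition complement pi : 'S_k := (pi * perm (@rev_ord_inj k))%g.

Lemma complementE pi i : complement pi i = rev_ord (pi i).
Proof. by rewrite permM permE. Qed.

Lemma complementK : involutive complement.
Proof. by move=> pi; apply/permP => i; rewrite !complementE rev_ordK. Qed.

Lemma rev_ord_lt m (i j : 'I_m) : (rev_ord i < rev_ord j) = (j < i).
Proof. by move: (ltn_ord i) (ltn_ord j) => /=; lia. Qed.

(** Complementing the vertex labels carries forests avoiding [pi] injectively to forests avoiding
    its complement. *)
Lemma leq_complement pi n : num_cavoid n pi <= num_cavoid n (complement pi).
Proof.
pose F (p : {ffun 'I_n -> option 'I_n}) := [ffun v => omap (@rev_ord n) (p (rev_ord v))].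
have omapK : involutive (omap (@rev_ord n)) by case=> //= i; rewrite rev_ordK.
have FK : involutive F by move=> p; apply/ffunP => v; rewrite !ffunE rev_ordK omapK.
rewrite /num_cavoid -(card_imset _ (inv_inj FK)).
apply/subset_leq_card/subsetP => q /imsetP[p]; rewrite inE => /andP[fp ap] ->.
rewrite inE; apply/andP; split.
  apply/forallP => v; move/forallP/(_ (rev_ord v)): fp.
  suff -> : iter n (parent_step (F p)) (Some v) =
            omap (@rev_ord n) (iter n (parent_step p) (Some (rev_ord v))).
    by move=> /eqP ->.
  elim: (X in iter X) => [|m IH] /=; first by rewrite rev_ordK.
  by rewrite IH; case: (iter m _ _) => //= z; rewrite ffunE rev_ordK.
apply: contra ap => /existsP[v /andP[/forallP par /forallP ord]].
apply/existsP; exists [ffun i => rev_ord (v i)]; apply/andP.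
split; apply/forallP => i; apply/forallP => j; rewrite !ffunE.
  apply/implyP => ij; move/forallP/(_ j)/implyP/(_ ij): (par i).
  by rewrite ffunE => /eqP E; rewrite -[p _]omapK E.
move/forallP/(_ i): (ord j) => /eqP; rewrite !complementE !rev_ord_lt => ->.
by rewrite eqxx.
Qed.

Lemma complement_equiv pi : cforest_wilf_equiv pi (complement pi).
Proof.
move=> n; apply/eqP; rewrite eqn_leq leq_complement /=.
by have := leq_complement (complement pi) n; rewrite complementK.
Qed.

End Complement.

(** * Counting the patterns obtained *)

(** The shift by 2 skips positions 0 and 1, which have no later entry on their side and so offer no
    choice. *)
Definition set_word m (A : {set 'I_m}) : pred nat := fun j => [exists i in A, i.+2 == j].

Lemma set_wordE m (A : {set 'I_m}) (i : 'I_m) : set_word A i.+2 = (i \in A).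
Proof.
apply/exists_inP/idP => [[j jA /eqP [/val_inj <-]] //|iA].
by exists i.
Qed.

(** Positions [i.+2] and [i] are neighbours on one side, and their comparison reads off the letter
    at [i.+2]. *)
Lemma pattern_inj m : injective (fun A : {set 'I_m} => pattern m.+2 (set_word A)).
Proof.
move=> A B E; apply/setP => i; rewrite -!set_wordE.
have lt w : word_lt m.+2 w i.+2 i = w i.+2.
  have im := ltn_ord i; rewrite /word_lt /side.
  have -> : (m.+2 < i.+2) || (m.+2 < i) = false by lia.
  have -> : odd (m.+2 - i.+2) = odd (m.+2 - i) by lia.
  have -> : i.+2 < m.+2 by [].
  have -> : i < m.+2 by lia.
  by rewrite eqxx ltnW.
have lt2 : i.+2 < m.+2.+3 by have := ltn_ord i; lia.
have lt0 : i < m.+2.+3 by lia.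
rewrite -!lt -[i.+2]/(val (Ordinal lt2)) -[val i]/(val (Ordinal lt0)).
by rewrite -(rev_ordK (Ordinal lt2)) -(rev_ordK (Ordinal lt0)) -!patternE E.
Qed.

(* "a class containing at least 2^(n-4) patterns of length n" is rendered as a
   set S of length-n patterns, pairwise c-forest-Wilf equivalent (hence inside
   one class), with |S| >= 2^(n-4), i.e. 2^n <= 16 * |S| (exact over the reals). *)
Theorem theorem1p5 : forall n : nat, 0 < n ->
  exists S : {set 'S_n},
    (forall p q : 'S_n, p \in S -> q \in S -> cforest_wilf_equiv p q) /\
    2 ^ n <= 16 * #|S|.
Proof.
move=> n _; case: (ltnP n 5) => n5.
  (* For [n <= 4] one pattern suffices, as [2 ^ n <= 16]. *)
  exists [set 1%g]; split=> [p q /set1P -> /set1P -> //|].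
  by rewrite cards1; case: n n5 => [|[|[|[|[]]]]].
have {n5}[m ->] : exists m, n = m.+2.+3 by exists (n - 5); lia.
pose P := [set pattern m.+2 (set_word A) | A : {set 'I_m}].
pose Q := [set complement pi | pi in P].
have cardP : #|P| = 2 ^ m.
  rewrite (card_imset _ (@pattern_inj m)).
  by rewrite -cardsT -powersetT card_powerset cardsT card_ord.
have cardQ : #|Q| = 2 ^ m by rewrite -cardP; apply/card_imset/inv_inj/complementK.
exists (P :|: Q); split.
  have equivP q : q \in P :|: Q -> cforest_wilf_equiv q (pattern m.+2 pred0).
    case/setUP => [/imsetP[A _ ->]|/imsetP[_ /imsetP[A _ ->] ->]] n'.
      exact: pattern_equiv.
    by rewrite -complement_equiv; apply: pattern_equiv.
  by move=> p q /equivP Ep /equivP Eq n'; rewrite Ep Eq.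
(* Word patterns start below their last entry, complements start above theirs. *)
have PQ : [disjoint P & Q].
  have first_lt (A : {set 'I_m}) : pattern m.+2 (set_word A) ord0 < pattern m.+2 (set_word A) ord_max.
    by rewrite patternE word_lt_low //=; lia.
  apply/pred0P => q /=; apply/negP => /andP[/imsetP[A _ ->] /imsetP[_ /imsetP[B _ ->] E]].
  by have := first_lt A; rewrite E !complementE rev_ord_lt ltnNge ltnW ?first_lt.
by rewrite cardsU (disjoint_setI0 PQ) cards0 subn0 cardP cardQ !expnS; lia.
Qed.
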